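(* For every integer $c \geq 4$, the free nilpotent group $N_{2c}$ of rank $2$ and nilpotency class $c$ satisfies the $R_\infty$ property; that is, $R(\varphi)=\infty$ for every automorphism $\varphi$ of $N_{2c}$.
   Context: The free nilpotent group $N_{rc}$ of rank $r$ and class $c$ is $F_r/\gamma_{c+1}(F_r)$, where $F_r$ is the free group of rank $r$ and $\gamma_i$ denotes the $i$-th term of the lower central series ($\gamma_1(G)=G$). Automorphisms are written on the right: $x\varphi$ is the image of $x$ under $\varphi$. For a group $G$ and an automorphism $\varphi$ of $G$, elements $g,f\in G$ are $\varphi$-twisted conjugate if there exists $x\in G$ with $(x\varphi)g = fx$. This is an equivalence relation; the Reidemeister number $R(\varphi)$ is the number of its equivalence classes, with $R(\varphi)=\infty$ if there are infinitely many. A group $G$ has the $R_\infty$ property if $R(\varphi)=\infty$ for every automorphism $\varphi$ of $G$. *)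

(* Defs.v *)
From HB Require Import structures.
From mathcomp Require Import all_boot finmap.
From mathcomp Require Import boolp classical_sets cardinality constructive_ereal.

Set Implicit Arguments.
Unset Strict Implicit.
Unset Printing Implicit Defensive.

Local Open Scope quotient_scope.
Local Open Scope classical_set_scope.
Local Open Scope group_scope.

(* The letter (x, true) stands for the generator x and (x, false) for its
   inverse. *)
Section Words.
Variable X : choiceType.
Implicit Types (a b : X * bool) (u v w : seq (X * bool)).

Definition flip a : X * bool := (a.1, ~~ a.2).

Definition reduced w : bool := sorted (fun a b => b != flip a) w.

Definition push a w : seq (X * bool) :=
  if w is b :: w' then if b == flip a then w' else a :: w else [:: a].

(* The reduced form of u ++ v, when v is already reduced. *)
Definition mulw u v : seq (X * bool) := foldr push v u.

Definition invw w : seq (X * bool) := rev (map flip w).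

Lemma flipK : involutive flip.
Proof. by case=> x b; rewrite /flip /= negbK. Qed.

Lemma reduced_push a w : reduced w -> reduced (push a w).
Proof.
case: w => [|b w] //= rw; case: ifP => [_|/negbT nba]; first exact: path_sorted rw.
by rewrite /reduced /= nba.
Qed.

Lemma reduced_mulw u v : reduced v -> reduced (mulw u v).
Proof. by move=> rv; elim: u => //= a u; apply: reduced_push. Qed.

Lemma reduced_invw w : reduced w -> reduced (invw w).
Proof.
rewrite /reduced /invw rev_sorted sorted_map; apply: sub_sorted => a b /=.
by apply: contra => /eqP/(can_inj flipK)->; rewrite flipK.
Qed.

Lemma pushK a w : reduced w -> push a (push (flip a) w) = w.
Proof.
case: w => [|b w] /=; first by rewrite eqxx.
rewrite flipK; have [-> | nba _ /=] := eqVneq b a; last by rewrite eqxx.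
by case: w => [|d w] //= /andP[/negbTE->].
Qed.

Lemma mulw_push a u w : reduced w -> mulw (push a u) w = push a (mulw u w).
Proof.
move=> rw; case: u => [|b u] //=; case: ifP => [/eqP->|//].
by rewrite pushK // reduced_mulw.
Qed.

Lemma mulwA u v w : reduced w -> mulw u (mulw v w) = mulw (mulw u v) w.
Proof. by move=> rw; elim: u => //= a u ->; rewrite mulw_push. Qed.

Lemma mulw_nil w : reduced w -> mulw w [::] = w.
Proof.
elim: w => [|a w IHw] //= rw; rewrite -/(mulw w _) IHw; last exact: path_sorted rw.
by case: w rw {IHw} => [|b w] //= /andP[/negbTE->].
Qed.

Lemma mulVw w : mulw (invw w) w = [::].
Proof.
elim: w => [|a w IHw] //; rewrite /invw /= rev_cons /mulw foldr_rcons /= flipK.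
by rewrite eqxx.
Qed.

Lemma invwK : involutive invw.
Proof. by move=> w; rewrite /invw map_rev revK mapK //; apply: flipK. Qed.

Record free_group := FreeGroup {
  word_of : seq (X * bool);
  word_ofP : reduced word_of
}.

HB.instance Definition _ := [isSub for word_of].
HB.instance Definition _ := [Choice of free_group by <:].

Definition fg_one : free_group := @FreeGroup [::] isT.
Definition fg_mul (x y : free_group) : free_group :=
  FreeGroup (reduced_mulw (word_of x) (word_ofP y)).
Definition fg_inv (x : free_group) : free_group :=
  FreeGroup (reduced_invw (word_ofP x)).

Lemma fg_mulA : associative fg_mul.
Proof. by move=> x y z; apply/val_inj/mulwA/word_ofP. Qed.
Lemma fg_mul1 : left_id fg_one fg_mul.
Proof. by move=> x; apply: val_inj. Qed.
Lemma fg_mulr1 : right_id fg_one fg_mul.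
Proof. by move=> x; apply/val_inj/mulw_nil/word_ofP. Qed.
Lemma fg_mulV : left_inverse fg_one fg_inv fg_mul.
Proof. by move=> x; apply/val_inj/mulVw. Qed.
Lemma fg_mulrV : right_inverse fg_one fg_inv fg_mul.
Proof.
by move=> x; apply: val_inj; rewrite /= -[in mulw _](invwK (word_of x)) mulVw.
Qed.

HB.instance Definition _ :=
  isGroup.Build free_group fg_mulA fg_mul1 fg_mulr1 fg_mulV fg_mulrV.

End Words.

Section Subgroups.
Variable G : groupType.
Implicit Types (H K : set G).

Definition subgroup_set H : Prop :=
  H 1 /\ forall x y, H x -> H y -> H (x / y).

Definition gen_subgroup (A : set G) : set G := smallest subgroup_set A.

Definition comm_subgroup H K : set G :=
  gen_subgroup [set z | exists x y, [/\ H x, K y & z = [~ x, y]]].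

(* As for mathcomp's 'L_n(G), the series starts at n = 1; the value at n = 0
   is also the whole group. *)
Definition lower_central n : set G :=
  iter n.-1 (fun H => comm_subgroup H setT) setT.

Definition normal_set H : Prop := forall x y, H x -> H (x ^ y).

Record normal_subgroup := NormalSubgroup {
  normal_val : set G;
  normal_subgroupP : subgroup_set normal_val;
  normal_normP : normal_set normal_val
}.

Lemma gen_subgroupP A : subgroup_set (gen_subgroup A).
Proof.
split; first by move=> H [[]].
move=> x y Ax Ay H sH; have [_ Hd] := sH.1.
by apply: Hd; [apply: Ax | apply: Ay].
Qed.

Lemma lower_central_subgroup n : subgroup_set (lower_central n).
Proof.
by rewrite /lower_central; case: n.-1 => [|m] //=; apply: gen_subgroupP.
Qed.

Lemma lower_central_normal n : normal_set (lower_central n).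
Proof.
rewrite /lower_central; elim: n.-1 => [|m IHm] //= x y Hx.
pose J := [set z | comm_subgroup (iter m (fun H => comm_subgroup H setT) setT)
                     setT (z ^ y)].
apply: (Hx J); split=> [|z [a [b [Ha _ ->]]]].
  have [H1 Hd] := gen_subgroupP [set z | exists a b,
    [/\ iter m (fun H => comm_subgroup H setT) setT a, setT b & z = [~ a, b]]].
  split; first by rewrite /J /= conj1g.
  by move=> a b Ja Jb; rewrite /J /= conjMg conjVg; apply: Hd.
rewrite /J /= conjRg; apply: sub_gen_smallest.
by exists (a ^ y), (b ^ y); split=> //; apply: IHm.
Qed.

Definition lower_central_subg n : normal_subgroup :=
  NormalSubgroup (lower_central_subgroup n) (@lower_central_normal n).

End Subgroups.

Section Quotient.
Variables (G : groupType) (N : normal_subgroup G).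
Implicit Types x y z : G.
Local Notation nN := (normal_val N).

Definition coset_rel x y : bool := `[< nN (x^-1 * y) >].

Lemma normal1 : nN 1. Proof. by have [] := normal_subgroupP N. Qed.
Lemma normalV x : nN x -> nN x^-1.
Proof.
by move=> Nx; rewrite -div1g; apply: (normal_subgroupP N).2 => //; apply: normal1.
Qed.
Lemma normalM x y : nN x -> nN y -> nN (x * y).
Proof.
move=> Nx Ny; rewrite -[y]invgK; apply: (normal_subgroupP N).2 => //.
exact: normalV.
Qed.

Lemma coset_rel_refl : reflexive coset_rel.
Proof. by move=> x; apply/asboolP; rewrite mulVg; apply: normal1. Qed.
Lemma coset_rel_sym : symmetric coset_rel.
Proof.
by move=> x y; apply/asboolP/asboolP => /normalV; rewrite invgM invgK.
Qed.
Lemma coset_rel_trans : transitive coset_rel.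
Proof.
move=> y x z /asboolP xy /asboolP yz; apply/asboolP.
by rewrite -[z](mulVKg y) mulgA; apply: normalM.
Qed.

Canonical coset_equiv :=
  EquivRel coset_rel coset_rel_refl coset_rel_sym coset_rel_trans.

Definition quotient_group := {eq_quot coset_equiv}.
HB.instance Definition _ := Choice.on quotient_group.
HB.instance Definition _ := EqQuotient.on quotient_group.

Definition qproj (x : G) : quotient_group := \pi_quotient_group x.

Definition qg_one : quotient_group := qproj 1.
Definition qg_mul (a b : quotient_group) : quotient_group :=
  qproj (repr a * repr b).
Definition qg_inv (a : quotient_group) : quotient_group := qproj (repr a)^-1.

Lemma qprojK (a : quotient_group) : qproj (repr a) = a.
Proof. exact: reprK. Qed.

Lemma qproj_eqP x y : nN (x^-1 * y) <-> qproj x = qproj y.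
Proof.
split=> [Nxy | /(@eqmodP _ coset_equiv) /asboolP //].
by apply/(@eqmodP _ coset_equiv)/asboolP.
Qed.

Lemma repr_qproj x : nN (x^-1 * repr (qproj x)).
Proof. by apply/qproj_eqP; rewrite qprojK. Qed.

Lemma qproj_mul x y : qg_mul (qproj x) (qproj y) = qproj (x * y).
Proof.
apply/esym/qproj_eqP; set x' := repr _; set y' := repr _.
have -> : (x * y)^-1 * (x' * y') = (x^-1 * x') ^ y * (y^-1 * y').
  by rewrite conjgE invgM !mulgA mulgK.
apply: normalM; last exact: repr_qproj.
by apply: normal_normP; apply: repr_qproj.
Qed.

Lemma qproj_inv x : qg_inv (qproj x) = qproj x^-1.
Proof.
apply/esym/qproj_eqP; rewrite invgK; set x' := repr _.
have -> : x * x'^-1 = ((x^-1 * x')^-1) ^ x^-1.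
  by rewrite conjgE invgM !invgK !mulgA mulgK.
by apply/normal_normP/normalV/repr_qproj.
Qed.

Lemma qg_mulA : associative qg_mul.
Proof.
by move=> a b d; rewrite -[a]qprojK -[b]qprojK -[d]qprojK !qproj_mul mulgA.
Qed.
Lemma qg_mul1 : left_id qg_one qg_mul.
Proof. by move=> a; rewrite -[a]qprojK qproj_mul mul1g. Qed.
Lemma qg_mulr1 : right_id qg_one qg_mul.
Proof. by move=> a; rewrite -[a]qprojK qproj_mul mulg1. Qed.
Lemma qg_mulV : left_inverse qg_one qg_inv qg_mul.
Proof. by move=> a; rewrite -[a]qprojK qproj_inv qproj_mul mulVg. Qed.
Lemma qg_mulrV : right_inverse qg_one qg_inv qg_mul.
Proof. by move=> a; rewrite -[a]qprojK qproj_inv qproj_mul mulgV. Qed.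

HB.instance Definition _ :=
  isGroup.Build quotient_group qg_mulA qg_mul1 qg_mulr1 qg_mulV qg_mulrV.

End Quotient.

Definition free_nilpotent_group (r c : nat) : groupType :=
  quotient_group (lower_central_subg (free_group 'I_r) c.+1).

Section Reidemeister.
Variable G : groupType.
Implicit Type phi : G -> G.

Definition twisted_conj phi (g f : G) : Prop := exists x, phi x * g = f * x.

Definition twisted_class phi (g : G) : set G := [set f | twisted_conj phi g f].

(* Only meant for phi an automorphism, in which case [twisted_conj phi] is an
   equivalence relation. *)
Definition reidemeister_number phi : \bar nat :=
  let classes := range (twisted_class phi) in
  if pselect (finite_set classes) then EFin #|` fset_set classes| else +oo%E.

Definition R_infty : Prop :=
  forall phi : {multiplicative G -> G},
    bijective phi -> reidemeister_number phi = +oo%E.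

End Reidemeister.

(* Main.v *)
From HB Require Import structures.
From mathcomp Require Import all_boot all_algebra.
From mathcomp Require Import boolp classical_sets functions cardinality.
From mathcomp Require Import constructive_ereal zify ring.
Require Import Defs.

Set Implicit Arguments.
Unset Strict Implicit.
Unset Printing Implicit Defensive.

(** The group N of rank 2 and class c is studied through the Magnus expansion,
    which sends the generator x_i of the free group F to 1 + X_i in the ring of
    power series in noncommuting variables over the integers.  An element of the
    k-th term of the lower central series has an expansion of the form 1 + (terms
    of degree at least k), so the expansion is defined on N modulo degree c + 1.
    The theorem then becomes a question of linear algebra on leading terms.

    An endomorphism phi of N acts on expansions as the substitution
    X_i := (expansion of phi x_i) - 1 ([mag_subst]).  On the lowest homogeneous
    part, of degree k say, this is the k-th tensor power of the matrix A of phi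
    on the abelianization ([mag_lead]).  Suppose that no tensor power of degree
    less than k has a nonzero fixed vector, and that L is a linear form in degree
    k which is invariant under the k-th tensor power of A.  If
    phi(x) z^n = z^p x with z of leading degree k, then the leading term of x
    must have degree at least k, and applying L in degree k gives
    n L(z) = p L(z).  Hence, if L(z) <> 0, the elements z^n lie in distinct
    twisted classes ([reidemeister_infinite]).

    When phi is an automorphism, A is invertible over the integers, with
    determinant d = 1 or d = -1 and trace t.  Three cases cover all phi:
    - 1 is an eigenvalue of A: take k = 1, z a generator, and for L an invariant
      linear form on Z^2.
    - d = 1: take k = 2, z = [x_0, x_1], and for L the area form, which A
      multiplies by d.
    - d = -1 and t <> 0: take k = 4.  For the area form w, the bilinear form
      b(u, v) = w(u, A v) is also multiplied by d, so L = w (x) b is multiplied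
      by d^2 = 1.  On z = [x_0, x_1, x_v, x_v] it takes the value 4 b(v, v), and
      b(v, v) vanishes for both v only if A is diagonal, when t = 0.  The tensor
      powers of degrees 1, 2, 3 have no fixed vectors, as the eigenvalues of A
      are real, of absolute value different from 1 and of product -1; an
      elementary proof based on A^2 = t A + 1 is given ([no_fixed1],
      [no_fixed2], [no_fixed3]). *)

Import GRing.Theory.

Local Open Scope classical_set_scope.
Local Open Scope ring_scope.

(** * Noncommutative power series *)

Section Series.
Variable X : eqType.

(** A power series is the function giving the coefficient of each word. *)
Definition series := seq X -> int.
HB.instance Definition _ := GRing.Zmodule.copy series (seq X -> int).

Implicit Types (f g h : series) (w : seq X) (i j : X).

(** Every series is uniquely f [::] plus the sum of the X_i * shift i f; the
    recursions below on words and on degrees follow this decomposition. *)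
Definition shift i f : series := fun w => f (i :: w).

(** This is the sum of f u * g v over the factorizations w = u ++ v.  The
    recursion peels off the first letter of u, which turns associativity and
    degree estimates into inductions on w. *)
Fixpoint series_mul f g w : int :=
  if w is i :: w' then f [::] * g w + series_mul (shift i f) g w'
  else f [::] * g [::].

Definition series_one : series := fun w => (w == [::])%:R.

Lemma addsE f g w : (f + g) w = f w + g w. Proof. by []. Qed.
Lemma oppsE f w : (- f) w = - f w. Proof. by []. Qed.
Lemma mulrzsE f (c : int) w : (f *~ c) w = f w * c.
Proof.
have nat_case (n : nat) : (f *+ n) w = f w * n%:Z.
  elim: n => [|n IHn]; first by rewrite mulr0n mulr0.
  by rewrite mulrS addsE IHn intS mulrDr mulr1.
case: c => n; first by rewrite -pmulrn nat_case.
by rewrite NegzE mulrNz -pmulrn oppsE nat_case mulrN.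
Qed.

Lemma shiftD i f g : shift i (f + g) = shift i f + shift i g.
Proof. by []. Qed.
Lemma shiftMz i f c : shift i (f *~ c) = shift i f *~ c.
Proof. by apply/funext => w; rewrite /shift !mulrzsE. Qed.

Lemma series_mulDl : left_distributive series_mul +%R.
Proof.
move=> f g h; apply/funext => w.
elim: w f g h => [|i w IHw] f g h; rewrite addsE /= addsE mulrDl //.
by rewrite shiftD IHw addsE addrACA.
Qed.

Lemma series_mulDr : right_distributive series_mul +%R.
Proof.
move=> f g h; apply/funext => w.
elim: w f g h => [|i w IHw] f g h; rewrite addsE /= addsE mulrDr //.
by rewrite IHw addsE addrACA.
Qed.

Lemma series_mulz f g c : series_mul (f *~ c) g = series_mul f g *~ c.
Proof.
apply/funext => w; elim: w f => [|i w IHw] f /=; rewrite !mulrzsE /=.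
  by rewrite mulrAC.
by rewrite shiftMz IHw mulrzsE mulrDl mulrAC.
Qed.

Lemma shift_series_mul i f g :
  shift i (series_mul f g) = shift i g *~ f [::] + series_mul (shift i f) g.
Proof. by apply/funext => w; rewrite addsE mulrzsE mulrC. Qed.

Lemma series_mulA : associative series_mul.
Proof.
move=> f g h; apply/funext => w.
elim: w f => [|i w IHw] f /=; first by rewrite mulrA.
rewrite shift_series_mul series_mulDl series_mulz addsE mulrzsE -IHw.
by rewrite mulrDr !mulrA addrA [_ * f [::]]mulrC.
Qed.

Lemma shift_one i : shift i series_one = 0.
Proof. by apply/funext. Qed.

Lemma series_mul1 : left_id series_one series_mul.
Proof.
move=> f; apply/funext => -[|i w] /=; rewrite mul1r //.
rewrite shift_one.
suff -> : series_mul 0 f = 0 by rewrite addr0.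
by rewrite -(mulr0z (0 : series)) series_mulz mulr0z.
Qed.

Lemma series_mulr1 : right_id series_one series_mul.
Proof.
move=> f; apply/funext => w; elim: w f => [|i w IHw] f /=; first by rewrite mulr1.
by rewrite mulr0 add0r IHw.
Qed.

HB.instance Definition _ := GRing.Zmodule_isPzRing.Build series
  series_mulA series_mul1 series_mulr1 series_mulDl series_mulDr.

Lemma onesE w : (1 : series) w = (w == [::])%:R. Proof. by []. Qed.
Lemma mulsE0 f g : (f * g) [::] = f [::] * g [::]. Proof. by []. Qed.
Lemma mulsES f g i w :
  (f * g) (i :: w) = f [::] * g (i :: w) + (shift i f * g) w.
Proof. by []. Qed.
Lemma shiftM i f g : shift i (f * g) = shift i g *~ f [::] + shift i f * g.
Proof. exact: shift_series_mul. Qed.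

(** Membership in the ideal of the series without terms of degree less than k.
    Congruence modulo this ideal is written vanish k (f - g). *)
Definition vanish k f := forall w, (size w < k)%N -> f w = 0.

Lemma vanishW k l f : (l <= k)%N -> vanish k f -> vanish l f.
Proof. by move=> lk vf w wl; apply: vf; apply: leq_trans lk. Qed.

Lemma vanish0 k : vanish k 0. Proof. by []. Qed.
Lemma vanishD k f g : vanish k f -> vanish k g -> vanish k (f + g).
Proof. by move=> vf vg w wk; rewrite addsE vf ?vg. Qed.
Lemma vanishN k f : vanish k f -> vanish k (- f).
Proof. by move=> vf w wk; rewrite oppsE vf. Qed.
Lemma vanishB k f g : vanish k f -> vanish k g -> vanish k (f - g).
Proof. by move=> vf vg; apply/vanishD/vanishN. Qed.
Lemma vanish_sum k (J : finType) (F : J -> series) :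
  (forall a, vanish k (F a)) -> vanish k (\sum_a F a).
Proof.
move=> vF; elim/big_rec: _ => [|a f _ vf]; first exact: vanish0.
exact: vanishD.
Qed.

Lemma vanishM k l f g : vanish k f -> vanish l g -> vanish (k + l) (f * g).
Proof.
move=> vf vg w; elim: w k f vf => [|i w IHw] k f vf.
  case: k vf => [|k] vf; rewrite mulsE0; first by move/vg->; rewrite mulr0.
  by rewrite vf // mul0r.
rewrite mulsES; case: k vf => [|k] vf wkl.
  by rewrite (IHw 0%N) ?vg ?mulr0 //=; apply: ltnW.
by rewrite vf // mul0r add0r (IHw k) // => v vk; apply: vf.
Qed.

Lemma vanishMl l f g : vanish l g -> vanish l (f * g).
Proof. by apply: (@vanishM 0 l). Qed.
Lemma vanishMr l f g : vanish l g -> vanish l (g * f).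
Proof. by move=> vg; rewrite -[l]addn0; apply: vanishM. Qed.

Lemma lead_mull f g w : vanish (size w) g -> (f * g) w = f [::] * g w.
Proof.
case: w => [|i w] vg //; rewrite mulsES (@vanishMl (size w).+1) ?addr0 //.
Qed.

Lemma eqmodM k (f f' g g' : series) : vanish k (f - f') -> vanish k (g - g') ->
  vanish k (f * g - f' * g').
Proof.
move=> vf vg; rewrite -(subrK (f' * g) (f * g)) -addrA -mulrBl -mulrBr.
by apply: vanishD; [apply: vanishMr | apply: vanishMl].
Qed.

Lemma eqmod_trans k f g h :
  vanish k (f - g) -> vanish k (g - h) -> vanish k (f - h).
Proof. by move=> vf vg; rewrite -(subrK g f) -addrA; apply: vanishD. Qed.

Lemma eqmod_sym k f g : vanish k (f - g) -> vanish k (g - f).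
Proof. by rewrite -opprB => vf; rewrite -[g - f]opprK; apply: vanishN. Qed.

Definition gen i : series := fun w => (w == [:: i])%:R.

(** The inverse of 1 + X_i. *)
Definition geom i : series :=
  fun w => if all (pred1 i) w then (-1) ^+ size w else 0.

Lemma vanish_gen i : vanish 1 (gen i).
Proof. by case. Qed.

Lemma shift_gen i j : shift j (gen i) = (1 : series) *~ (i == j).
Proof.
apply/funext => w; rewrite mulrzsE onesE /shift /gen eqseq_cons eq_sym.
by case: (i == j); case: w.
Qed.

Lemma shift_geom i j : shift j (geom i) = - (geom i *~ (i == j)).
Proof.
apply/funext => v; rewrite oppsE mulrzsE /shift /geom /= [j == i]eq_sym.
case: (i == j); rewrite /= ?mulr0 ?oppr0 ?mulr1 //.
by case: all; rewrite ?oppr0 // exprS mulN1r.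
Qed.

Lemma mul_gen_geom i : (1 + gen i) * geom i = 1.
Proof.
apply/funext => -[|j w] //; rewrite mulsES shiftD shift_gen shift_one add0r.
rewrite mulrzAl mul1r -[geom i (j :: w)]/(shift j (geom i) w) shift_geom.
by rewrite mul1r oppsE addNr.
Qed.

Lemma mul_geom_gen i : geom i * (1 + gen i) = 1.
Proof.
apply/funext; elim=> [|j w IHw] //; rewrite mulsES shift_geom.
rewrite mulNr mulrzAl oppsE mulrzsE IHw /= [geom i [::]]expr0 mul1r.
rewrite addsE !onesE /gen eqseq_cons [j == i]eq_sym add0r.
by case: (i == j); case: (w == [::]).
Qed.

End Series.

(** * Substitution of series for the variables *)

Section Substitution.
Variable X : finType.
Implicit Types (f g : series X) (w : seq X) (Y : X -> series X).

(** The substitution X_i := Y_i in the part of f of degree at most n.  When the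
    Y_i have no constant term, the terms of f of degree above n only contribute
    in degrees above n, so the truncation computes the full substitution modulo
    degree n + 1. *)
Fixpoint subst Y n f : series X :=
  1 *~ f [::] + if n is n'.+1 then \sum_i Y i * subst Y n' (shift i f) else 0.

Lemma substD Y n f g : subst Y n (f + g) = subst Y n f + subst Y n g.
Proof.
elim: n f g => [|n IHn] f g /=; rewrite addsE mulrzDr ?addr0 //.
rewrite addrACA -big_split /=; congr (_ + _).
by apply: eq_bigr => i _; rewrite shiftD IHn mulrDr.
Qed.

Lemma substMz Y n f c : subst Y n (f *~ c) = subst Y n f *~ c.
Proof.
elim: n f => [|n IHn] f /=; rewrite mulrzsE mulrzA ?addr0 //.
rewrite mulrzDl mulrz_suml; congr (_ + _).
by apply: eq_bigr => i _; rewrite shiftMz IHn mulrzAr.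
Qed.

Lemma subst0 Y n : subst Y n 0 = 0.
Proof. by rewrite -(mulr0z (0 : series X)) substMz mulr0z. Qed.

Lemma substB Y n f g : subst Y n (f - g) = subst Y n f - subst Y n g.
Proof. by rewrite substD -mulrN1z substMz mulrN1z. Qed.

Lemma subst1 Y n : subst Y n 1 = 1.
Proof.
case: n => [|n] /=; rewrite onesE mulr1z ?addr0 // big1 ?addr0 // => i _.
by rewrite shift_one subst0 mulr0.
Qed.

Lemma subst_gen Y n i : (0 < n)%N -> subst Y n (gen i) = Y i.
Proof.
case: n => // n _; rewrite /= vanish_gen // mulr0z add0r (bigD1 i) //=.
rewrite shift_gen eqxx mulr1z subst1 mulr1 big1 ?addr0 // => j ij.
by rewrite shift_gen eq_sym (negbTE ij) mulr0z subst0 mulr0.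
Qed.

Section Positive.
Variables (Y : X -> series X) (vY : forall i, vanish 1 (Y i)).

Lemma vanish_subst k n f : vanish k f -> vanish k (subst Y n f).
Proof.
elim: n k f => [|n IHn] [|k] f vf //; rewrite /= vf // mulr0z add0r //.
apply: vanish_sum => i; apply: (@vanishM _ 1 k) => //; apply: IHn => w wk.
exact: vf.
Qed.

Lemma subst_stable n f : vanish n.+1 (subst Y n.+1 f - subst Y n f).
Proof.
elim: n f => [|n IHn] f.
  rewrite /= addr0 [1 *~ _ + _]addrC addrK; apply: vanish_sum => i.
  exact: vanishMr.
rewrite [subst Y n.+2 f]/= [subst Y n.+1 f]/= opprD addrACA subrr add0r -sumrB.
apply: vanish_sum => i; rewrite -mulrBr; apply: (@vanishM _ 1 n.+1) => //.
exact: IHn.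
Qed.

(** Induction on n: by the product rule for shift, the two sides differ by terms
    Y_i * e with e vanishing to order n + 1, and Y_i raises that order by one. *)
Lemma substM n f g :
  vanish n.+1 (subst Y n (f * g) - subst Y n f * subst Y n g).
Proof.
elim: n f => [|n IHn] f.
  by rewrite /= !addr0 mulsE0 mulrzAl mul1r mulrC mulrzA subrr.
have -> : subst Y n.+1 (f * g) - subst Y n.+1 f * subst Y n.+1 g =
    \sum_i Y i *
       (subst Y n (shift i f * g) - subst Y n (shift i f) * subst Y n g)
    - (\sum_i Y i * (subst Y n (shift i f) * (subst Y n.+1 g - subst Y n g))).
  rewrite [subst Y n.+1 (f * g)]/= [subst Y n.+1 f]/= [subst Y n.+1 g in LHS]/=.
  set Sg := subst Y n.+1 g; rewrite -sumrB.
  have -> : 1 *~ g [::] + \sum_i Y i * subst Y n (shift i g) = Sg by [].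
  have -> : \sum_i Y i * subst Y n (shift i (f * g)) =
     (\sum_i Y i * subst Y n (shift i g)) *~ f [::] +
     \sum_i Y i * subst Y n (shift i f * g).
    rewrite mulrz_suml -big_split /=; apply: eq_bigr => i _.
    by rewrite shiftM substD substMz mulrDr mulrzAr.
  rewrite mulsE0 mulrC mulrzA addrA -mulrzDl mulrDl mulrzAl mul1r.
  rewrite opprD addrACA subrr add0r mulr_suml -sumrB; apply: eq_bigr => i _.
  by rewrite !mulrBr opprB !mulrA addrA subrK.
apply: vanishB; apply: vanish_sum => i; first exact: (@vanishM _ 1).
by apply: (@vanishM _ 1) => //; apply/vanishMl/subst_stable.
Qed.

End Positive.

(** On homogeneous series of degree k this is the k-th tensor power of A: the
    linear substitution of the sum of the A i j X_j for X_i. *)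
Fixpoint tensor_act (A : X -> X -> int) f w : int :=
  if w is j :: w' then \sum_i A i j * tensor_act A (shift i f) w' else f [::].

(** In the lowest degree of f only the linear parts of the Y_i contribute. *)
Lemma subst_lead Y n f w : (forall i, vanish 1 (Y i)) ->
    vanish (size w) f -> (size w <= n)%N ->
  subst Y n f w = tensor_act (fun i j => Y i [:: j]) f w.
Proof.
move=> vY; elim: w n f => [|j w IHw] n f vf.
  case: n => [|n] _; rewrite /= addsE mulrzsE mul1r ?addr0 //.
  rewrite (@vanish_sum _ 1) ?addr0 // => i; exact: vanishMr.
case: n => // n wn; rewrite /= vf // mulr0z add0r.
have vf' i : vanish (size w) (shift i f) by move=> v vw; apply: vf.
rewrite (_ : (\sum_i _) _ = \sum_i (Y i * subst Y n (shift i f)) (j :: w)).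
  apply: eq_bigr => i _; rewrite mulsES vY // mul0r add0r lead_mull.
    by rewrite IHw.
  exact: vanish_subst.
by elim/big_rec2: _ => // i _ s _ <-.
Qed.

End Substitution.

(** * The Magnus expansion *)

Section Magnus.
Variable X : finType.
Local Notation F := (free_group X).
Implicit Types (x y : F).

Definition letter (a : X * bool) : series X :=
  if a.2 then 1 + gen a.1 else geom a.1.

Lemma letter_flip a : letter a * letter (flip a) = 1.
Proof.
by case: a => i []; rewrite /letter /= (mul_gen_geom, mul_geom_gen).
Qed.

Definition magnus x : series X := \prod_(a <- word_of x) letter a.

Lemma magnus1 : magnus 1%g = 1.
Proof. by rewrite /magnus big_nil. Qed.

Lemma prod_push a (u : seq (X * bool)) :
  \prod_(b <- push a u) letter b = letter a * \prod_(b <- u) letter b.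
Proof.
case: u => [|b u] /=; first by rewrite big_cons.
case: ifP => [/eqP->|_]; last by rewrite big_cons.
by rewrite big_cons mulrA letter_flip mul1r.
Qed.

Lemma magnusM x y : magnus (x * y)%g = magnus x * magnus y.
Proof.
rewrite /magnus [word_of (x * y)%g]/(mulw (word_of x) (word_of y)) /mulw.
elim: (word_of x) => [|a u IHu]; first by rewrite big_nil mul1r.
by rewrite /= prod_push IHu big_cons mulrA.
Qed.

Lemma magnusV x : magnus x^-1%g * magnus x = 1.
Proof. by rewrite -magnusM mulVg magnus1. Qed.

Lemma magnus_const x : magnus x [::] = 1.
Proof.
rewrite /magnus; elim: word_of => [|a u IHu]; first by rewrite big_nil.
by rewrite big_cons mulsE0 IHu mulr1; case: a => i [].
Qed.

Lemma vanish_magnus1 x : vanish 1 (magnus x - 1).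
Proof. by case=> // _; rewrite addsE oppsE magnus_const. Qed.

Definition fg_gen (i : X) : F := @FreeGroup _ [:: (i, true)] isT.

Lemma magnus_gen i : magnus (fg_gen i) = 1 + gen i.
Proof. by rewrite /magnus big_cons big_nil mulr1. Qed.

Lemma fg_ind (P : F -> Prop) :
    P 1%g -> (forall i x, P x -> P (fg_gen i * x)%g) ->
    (forall i x, P x -> P ((fg_gen i)^-1 * x)%g) ->
  forall x, P x.
Proof.
move=> P1 Pg PV [u ru]; elim: u ru => [|a u IHu] ru.
  by rewrite (_ : FreeGroup ru = 1%g) //; apply: val_inj.
have ru' : reduced u by apply: path_sorted ru.
have push_u : push a u = a :: u.
  by case: u ru {IHu ru'} => [|b u] //= /andP[/negbTE-> _].
case: a ru push_u => i [] ru push_u.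
  rewrite (_ : FreeGroup ru = fg_gen i * FreeGroup ru')%g; first exact: Pg.
  exact/val_inj/esym.
rewrite (_ : FreeGroup ru = (fg_gen i)^-1 * FreeGroup ru')%g; first exact: PV.
exact/val_inj/esym.
Qed.

(** As x * y = y * x * [x, y], the expansion of the commutator is governed by the
    ring commutator of the two expansions. *)
Lemma magnus_commg x y : magnus [~ x, y]%g - 1 =
  magnus (y * x)^-1%g *
  ((magnus x - 1) * (magnus y - 1) - (magnus y - 1) * (magnus x - 1)).
Proof.
have -> : (magnus x - 1) * (magnus y - 1) - (magnus y - 1) * (magnus x - 1) =
    magnus (x * y)%g - magnus (y * x)%g.
  rewrite !magnusM !mulrBl !mulrBr !mul1r !mulr1; apply/funext => w.
  by rewrite !(addsE, oppsE); ring.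
rewrite mulrBr magnusV -magnusM; congr (magnus _ - _).
by rewrite commgEl conjgE invgM !mulgA.
Qed.

(** One of the factors always contributes a positive degree, so commutators with
    arbitrary elements raise the order of vanishing. *)
Lemma vanish_commg k x y :
  vanish k (magnus x - 1) -> vanish k.+1 (magnus [~ x, y]%g - 1).
Proof.
move=> vx; rewrite magnus_commg; apply/vanishMl/vanishB.
  by rewrite -addn1; apply: vanishM => //; apply: vanish_magnus1.
by apply: (@vanishM _ 1) => //; apply: vanish_magnus1.
Qed.

Lemma commg_lead x y w : vanish (size w).-1 (magnus x - 1) ->
  (magnus [~ x, y]%g - 1) w = ((magnus x - 1) * (magnus y - 1)
     - (magnus y - 1) * (magnus x - 1)) w.
Proof.
case: w => [|i w] vx.
  by rewrite !addsE !oppsE !mulsE0 !addsE !oppsE !magnus_const subrr mul0r subrr.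
rewrite magnus_commg lead_mull ?magnus_const ?mul1r //; apply: vanishB.
  by rewrite /= -addn1; apply: vanishM => //; apply: vanish_magnus1.
by apply: (@vanishM _ 1) => //; apply: vanish_magnus1.
Qed.

Lemma vanish_subgroup k :
  subgroup_set (fun x : F => vanish k (magnus x - 1)).
Proof.
split=> [|x y vx vy]; first by rewrite magnus1 subrr; apply: vanish0.
have -> : magnus (x / y)%g - 1 =
    ((magnus x - 1) - (magnus y - 1)) * magnus y^-1%g.
  by rewrite opprB addrA subrK mulrBl -!magnusM mulgV magnus1.
by apply/vanishMr/vanishB.
Qed.

Lemma vanish_lower_central k x :
  lower_central (G := F) k.+1 x -> vanish k.+1 (magnus x - 1).
Proof.
elim: k x => [|k IHk] x; first by move=> _; apply: vanish_magnus1.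
move=> x_in; apply: (x_in (fun y => vanish k.+2 (magnus y - 1))).
split=> [|_ [y [z [y_in _ ->]]]]; first exact: vanish_subgroup.
exact/vanish_commg/IHk.
Qed.

Lemma magnus_eq_mod k x y : lower_central (G := F) k.+1 (x^-1 * y)%g ->
  vanish k.+1 (magnus y - magnus x).
Proof.
move/vanish_lower_central=> vxy.
have -> : magnus y - magnus x = magnus x * (magnus (x^-1 * y)%g - 1).
  by rewrite mulrBr -magnusM mulgA mulgV mul1g mulr1.
exact: vanishMl.
Qed.

End Magnus.

Section Commutators.
Variable X : finType.
Implicit Types (f : series X) (i j v : X) (w : seq X).

Lemma magnus_gen_sub1 i : magnus (fg_gen i) - 1 = gen i.
Proof. by rewrite magnus_gen addrC addKr. Qed.

Lemma mul_gen_rcons f v w i : (f * gen v) (rcons w i) = f w * (v == i)%:R.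
Proof.
elim: w f => [|j w IHw] f; rewrite [rcons _ _]/= mulsES.
  rewrite mulsE0 [gen v [::]]vanish_gen // mulr0 addr0 /gen eqseq_cons andbT.
  by rewrite eq_sym.
rewrite IHw /gen eqseq_cons [_ == [::]](_ : _ = false); last by case: w {IHw}.
by rewrite andbF mulr0 add0r.
Qed.

Lemma gen_mul_cons f v w i : (gen v * f) (i :: w) = (v == i)%:R * f w.
Proof.
rewrite mulsES [gen v [::]]vanish_gen // mul0r add0r shift_gen mulrzAl mul1r.
by rewrite mulrzsE mulrC; case: eqP.
Qed.

Lemma commg_gen_lead (x : free_group X) v i j w :
    vanish (size w).+1 (magnus x - 1) ->
  (magnus [~ x, fg_gen v]%g - 1) (i :: rcons w j) =
    (magnus x - 1) (i :: w) * (v == j)%:R -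
    (v == i)%:R * (magnus x - 1) (rcons w j).
Proof.
move=> vx.
rewrite commg_lead /= ?size_rcons // magnus_gen_sub1 (addsE (_ * _)) oppsE.
by rewrite gen_mul_cons -[i :: rcons w j]/(rcons (i :: w) j) mul_gen_rcons.
Qed.

End Commutators.

(** * Endomorphisms and twisted conjugacy classes *)

Section NilpotentQuotient.
Variables (X : finType) (c : nat).
Hypothesis c_gt0 : (0 < c)%N.
Local Notation F := (free_group X).
Local Notation N := (lower_central_subg F c.+1).
Local Notation G := (quotient_group N).
Implicit Types (g h : G) (x y : F).

Lemma qprojM x y : qproj N (x * y)%g = (qproj N x * qproj N y)%g :> G.
Proof. by rewrite -qproj_mul. Qed.

Lemma qproj1 : qproj N 1%g = 1%g :> G. Proof. by []. Qed.

(** The expansion of an arbitrary lift; it is meaningful modulo degree c + 1. *)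
Definition mag g : series X := magnus (repr g).

Lemma mag_qproj x : vanish c.+1 (mag (qproj N x) - magnus x).
Proof. exact/magnus_eq_mod/repr_qproj. Qed.

Lemma magM g h : vanish c.+1 (mag (g * h)%g - mag g * mag h).
Proof. by rewrite -magnusM; apply: mag_qproj. Qed.

Lemma vanish_mag1 g : vanish 1 (mag g - 1).
Proof. exact: vanish_magnus1. Qed.

(** In the lowest degree k >= 1 the product xi * eta in
    (1 + xi) * (1 + eta) is invisible: leading terms add up. *)
Lemma magM_lead k g h :
    (0 < k <= c)%N -> vanish k (mag g - 1) -> vanish k (mag h - 1) ->
  vanish k (mag (g * h)%g - 1) /\
  forall w, size w = k ->
    (mag (g * h)%g - 1) w = (mag g - 1) w + (mag h - 1) w.
Proof.
move=> /andP[k_gt0 kc] vg vh.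
have E : mag (g * h)%g - 1 = (mag (g * h)%g - mag g * mag h) +
    (mag g - 1) * (mag h - 1) + ((mag g - 1) + (mag h - 1)).
  rewrite !mulrBl !mulrBr !mul1r !mulr1; apply/funext => w.
  by rewrite !(addsE, oppsE); ring.
have v1 : vanish k.+1
    (mag (g * h)%g - mag g * mag h + (mag g - 1) * (mag h - 1)).
  apply: vanishD; first by apply: vanishW (magM g h).
  by apply: (@vanishW _ (k + k)); [lia | apply: vanishM].
rewrite E; split=> [|w wk]; last by rewrite addsE v1 ?wk // add0r addsE.
by apply: vanishD; [apply: vanishW v1 | apply: vanishD].
Qed.

Section Endomorphism.
Variable phi : {multiplicative G -> G}.

Lemma mult1 : phi 1%g = 1%g.
Proof. by apply: (@mulgI _ (phi 1%g)); rewrite -gmulfM !mulg1. Qed.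

Definition image_series i : series X := mag (phi (qproj N (fg_gen i))) - 1.

(** The matrix of phi on the abelianization; row i is the image of the i-th
    generator. *)
Definition linear_part i j := image_series i [:: j].

Lemma vanish_image_series i : vanish 1 (image_series i).
Proof. exact: vanish_mag1. Qed.

Local Notation Y := image_series.
Local Notation vY := vanish_image_series.
Local Notation substituted x :=
  (vanish c.+1 (mag (phi (qproj N x)) - subst Y c (magnus x))).

Lemma substitutedM x y : substituted x -> substituted y -> substituted (x * y)%g.
Proof.
move=> Sx Sy; rewrite qprojM gmulfM.
apply: eqmod_trans (magM _ _) _; apply: eqmod_trans (eqmodM Sx Sy) _.
by rewrite magnusM; apply/eqmod_sym/substM/vY.
Qed.

Lemma mag1 : vanish c.+1 (mag 1%g - 1).
Proof. by have := mag_qproj 1%g; rewrite magnus1. Qed.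

(** Inverses are unique modulo degree c + 1. *)
Lemma substitutedV x : substituted x -> substituted x^-1%g.
Proof.
move=> Sx; set a := mag _; set s' := subst _ _ _.
have ab : vanish c.+1 (a * mag (phi (qproj N x)) - 1).
  apply: eqmod_trans (eqmod_sym (magM _ _)) _.
  rewrite -gmulfM -qprojM mulVg qproj1 mult1; apply: mag1.
have ss' : vanish c.+1 (subst Y c (magnus x) * s' - 1).
  apply: eqmod_trans (eqmod_sym (substM vY _ _)) _.
  by rewrite -magnusM mulgV magnus1 subst1 subrr; apply: vanish0.
have ass : vanish c.+1 (a - a * (subst Y c (magnus x) * s')).
  by rewrite -{1}[a]mulr1 -mulrBr; apply/vanishMl/eqmod_sym.
apply: eqmod_trans ass _; rewrite mulrA -{2}[s']mul1r -mulrBl.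
apply/vanishMr/(eqmod_trans _ ab); rewrite -mulrBr.
exact/vanishMl/eqmod_sym.
Qed.

Lemma substituted_all x : substituted x.
Proof.
have Sgen i : substituted (fg_gen i).
  rewrite magnus_gen substD subst1 subst_gen // addrC /image_series.
  rewrite [1 + _]addrC subrK addNr.
  exact: vanish0.
move: x; apply: fg_ind => [|i x Sx|i x Sx].
- by rewrite magnus1 subst1 qproj1 mult1; apply: mag1.
- exact: substitutedM (Sgen i) Sx.
- exact: substitutedM (substitutedV (Sgen i)) Sx.
Qed.

(** Both sides are multiplicative modulo degree c + 1 and agree on generators. *)
Lemma mag_subst g : vanish c.+1 (mag (phi g) - subst Y c (mag g)).
Proof. by have := substituted_all (repr g); rewrite qprojK. Qed.

Lemma mag_lead k g : (k <= c)%N -> vanish k (mag g - 1) ->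
  vanish k (mag (phi g) - 1) /\
  forall w, size w = k ->
    (mag (phi g) - 1) w = tensor_act linear_part (mag g - 1) w.
Proof.
move=> kc vg.
have E : mag (phi g) - 1 =
    (mag (phi g) - subst Y c (mag g)) + subst Y c (mag g - 1).
  by rewrite substB subst1 addrA subrK.
have v1 := mag_subst g; rewrite E; split=> [|w wk].
  by apply: vanishD; [apply: vanishW v1; apply: leqW | apply: (vanish_subst vY)].
by rewrite addsE v1 ?wk // add0r (subst_lead vY) ?wk.
Qed.

(** The criterion: the powers of z lie in pairwise distinct twisted classes. *)
Lemma reidemeister_infinite k (z : F) (L : series X -> int) :
    (0 < k <= c)%N ->
    (forall j f, (0 < j < k)%N ->
       (forall w, size w = j -> tensor_act linear_part f w = f w) ->
     forall w, size w = j -> f w = 0) ->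
    (forall f f', (forall w, size w = k -> f w = f' w) -> L f = L f') ->
    {morph L : f f' / f + f'} ->
    (forall f, L (tensor_act linear_part f) = L f) ->
    vanish k (magnus z - 1) -> L (magnus z - 1) <> 0 ->
  reidemeister_number phi = +oo%E.
Proof.
move=> kc nofix Lext LD Linv vz Lz.
pose zq : G := qproj N z.
have [k_gt0 k_le_c] := andP kc.
have zqE w : (size w <= k)%N -> (mag zq - 1) w = (magnus z - 1) w.
  move=> wk; apply/eqP; rewrite -subr_eq0; apply/eqP.
  have := @mag_qproj z w; rewrite !(addsE, oppsE) => <-; last by lia.
  by rewrite -/zq; ring.
have vzq : vanish k (mag zq - 1) by move=> w wk; rewrite zqE ?vz // ltnW.
have powz n : vanish k (mag (zq ^+ n)%g - 1) /\
    L (mag (zq ^+ n)%g - 1) = L (magnus z - 1) * n%:Z.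
  elim: n => [|n [vn Ln]].
    have v1 := mag1; split; first by apply: vanishW v1; apply: leqW.
    have L0 : L 0 = 0 by apply: (addrI (L 0)); rewrite -LD !addr0.
    by rewrite mulr0 -L0; apply: Lext => w wk; rewrite v1 // wk.
  have [v1 l1] := magM_lead kc vzq vn; rewrite expgS; split=> //.
  rewrite (Lext _ ((magnus z - 1) + (mag (zq ^+ n)%g - 1))); last first.
    by move=> w wk; rewrite l1 // zqE // wk.
  by rewrite LD Ln intS mulrDr mulr1.
have main n p (x : G) : (phi x * zq ^+ n)%g = (zq ^+ p * x)%g -> n = p.
  move=> xE; have [[vn Ln] [vp Lp]] := (powz n, powz p).
  (* Below degree k the powers of z do not contribute, so the leading term of x
     would be a fixed vector of a tensor power of the linear part. *)
  have vx j : (j <= k)%N -> vanish j (mag x - 1).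
    elim: j => [|j IHj] jk //; have vx := IHj (ltnW jk) => w.
    rewrite ltnS leq_eqVlt => /orP[/eqP wj|]; last exact: vx.
    have [j0|j_gt0] := posnP j; first by apply: vanish_mag1; rewrite wj j0.
    apply: (nofix j) wj; first by rewrite j_gt0.
    move=> v vj; have jc : (j <= c)%N by lia.
    have jc' : (0 < j <= c)%N by lia.
    have [vpx lpx] := mag_lead jc vx.
    have [_ l1] := magM_lead jc' vpx (vanishW (ltnW jk) vn).
    have [_ l2] := magM_lead jc' (vanishW (ltnW jk) vp) vx.
    rewrite -lpx // -[LHS]addr0 -(vn v) ?vj // -l1 // xE l2 // vp ?vj //.
    by rewrite add0r.
  (* In degree k, the form L does not distinguish x from phi x. *)
  have {}vx := vx k (leqnn k).
  have [vpx lpx] := mag_lead k_le_c vx.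
  have [_ l1] := magM_lead kc vpx vn.
  have [_ l2] := magM_lead kc vp vx.
  have : L ((mag (phi x) - 1) + (mag (zq ^+ n)%g - 1)) =
         L ((mag (zq ^+ p)%g - 1) + (mag x - 1)).
    by apply: Lext => w wk; rewrite !addsE -l1 // -l2 // xE.
  rewrite LD (LD (mag (zq ^+ p)%g - 1)) (Lext _ _ lpx) Linv Ln Lp addrC => /addIr.
  by move/(mulfI (introN eqP Lz)) => -[].
rewrite /reidemeister_number; case: pselect => // fin_classes; exfalso.
apply: infinite_nat.
have -> : [set: nat] = ((fun n => twisted_class phi (zq ^+ n)%g) @^-1`
    range (twisted_class phi)).
  by apply/seteqP; split=> // n _; exists (zq ^+ n)%g.
apply: finite_preimage fin_classes => n p _ _ eq_np.
have : twisted_class phi (zq ^+ p)%g (zq ^+ p)%g.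
  by exists 1%g; rewrite mult1 mul1g mulg1.
by rewrite -eq_np => -[x /main].
Qed.

End Endomorphism.

End NilpotentQuotient.

(** * Fixed vectors of tensor powers *)

(** In this part a, a1, a2, a3 are commuting operators with a^2 = t a + 1, such as
    the actions on the tensor factors of a 2 by 2 matrix of trace t and
    determinant -1.  In particular a has the inverse a - t, so an equation such as
    a1 a2 a3 f = f can be rewritten as a2 a3 f = a1 f - t f. *)
Section FixedVectors.
Variables (T : Type) (t : int).
Implicit Types (a b : (T -> int) -> T -> int) (f g : T -> int).

Definition linear_op a := forall m n f g p,
  a (fun q => m * f q + n * g q) p = m * a f p + n * a g p.

Definition quadratic_op a := forall f p, a (a f) p = t * a f p + f p.

Lemma linear_comb a f g h m n : linear_op a ->
  (forall p, h p = m * f p + n * g p) -> forall p, a h p = m * a f p + n * a g p.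
Proof.
move=> la hE p; rewrite -la; congr (a _ p); exact/funext.
Qed.

Lemma linear_op0 a f : linear_op a ->
  (forall p, f p = 0) -> forall p, a f p = 0.
Proof.
move=> la f0 p; rewrite (linear_comb (m := 0) (n := 0) (f := f) (g := f) la).
  by rewrite !mul0r addr0.
by move=> q; rewrite f0 mulr0 addr0.
Qed.

(** From a2 f = a1 f - t f, applying a2 and comparing with a2^2 = t a2 + 1 gives
    2 t a2 f = 0, and a2 is injective. *)
Lemma tensor2_no_fixed a1 a2 f : t != 0 ->
    quadratic_op a1 -> quadratic_op a2 -> linear_op a1 -> linear_op a2 ->
    (forall h, a1 (a2 h) = a2 (a1 h)) ->
  a1 (a2 f) = f -> forall p, f p = 0.
Proof.
move=> t0 q1 q2 l1 l2 C fixf.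
have a2f p : a2 f p = 1 * a1 f p + (- t) * f p.
  by have := q1 (a2 f) p; rewrite fixf; lia.
have a2f0 p : a2 f p = 0.
  have := linear_comb l2 a2f p; rewrite q2 -C fixf => E.
  by apply: (mulfI t0); lia.
by move=> p; have := q2 f p; rewrite (linear_op0 l2 a2f0) a2f0; lia.
Qed.

(** Put B = a2 a3.  Evaluating B^2 f once through B f = a1 f - t f and once through
    the quadratic equations gives (t + 1) B f + a2 f + a3 f = 0.  Since f plays the
    same role for the three operators, all a_i f coincide; calling the common value
    y, the remaining relations are (t + 3) y = t (t + 1) f and
    (t - 1) y = - (t + 1) f, so that (t + 1) (t^2 + 3) f = 0. *)
Lemma tensor3_no_fixed a1 a2 a3 f : t != 0 ->
    quadratic_op a1 -> quadratic_op a2 -> quadratic_op a3 ->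
    linear_op a1 -> linear_op a2 -> linear_op a3 ->
    (forall h, a1 (a2 h) = a2 (a1 h)) ->
    (forall h, a1 (a3 h) = a3 (a1 h)) ->
    (forall h, a2 (a3 h) = a3 (a2 h)) ->
  a1 (a2 (a3 f)) = f -> forall p, f p = 0.
Proof.
move=> t0.
have pair b1 b2 b3 :
    quadratic_op b1 -> quadratic_op b2 -> quadratic_op b3 ->
    linear_op b1 -> linear_op b2 -> linear_op b3 ->
    (forall h, b1 (b2 h) = b2 (b1 h)) ->
    (forall h, b1 (b3 h) = b3 (b1 h)) ->
    (forall h, b2 (b3 h) = b3 (b2 h)) -> b1 (b2 (b3 f)) = f ->
  (forall p, b2 (b3 f) p = 1 * b1 f p + (- t) * f p) /\
  (forall p, (t + 1) * (b1 f p - t * f p) + b2 f p + b3 f p = 0).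
  move=> q1 q2 q3 l1 l2 l3 C12 C13 C23 fixf.
  have Bf p : b2 (b3 f) p = 1 * b1 f p + (- t) * f p.
    by have := q1 (b2 (b3 f)) p; rewrite fixf; lia.
  split=> // p; apply: (mulfI t0).
  have l3B q : b3 (b2 (b3 f)) q = 1 * b3 (b1 f) q + (- t) * b3 f q.
    exact: linear_comb Bf q.
  have l23B q : b2 (b3 (b2 (b3 f))) q =
      1 * b2 (b3 (b1 f)) q + (- t) * b2 (b3 f) q.
    exact: linear_comb l3B q.
  have e1 q : b2 (b3 (b2 (b3 f))) q = f q - t * b2 (b3 f) q.
    by rewrite l23B -C13 -C12 fixf; lia.
  have e2 q : b3 (b3 f) q = t * b3 f q + 1 * f q by rewrite q3; lia.
  have e3 q : b2 (b3 (b3 f)) q = t * b2 (b3 f) q + 1 * b2 f q.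
    exact: linear_comb e2 q.
  have e4 q : b2 (b3 (b2 (b3 f))) q =
      t * b2 (b3 (b3 f)) q + b3 (b3 f) q by rewrite -C23 q2.
  have := e1 p; rewrite e4 e3 e2 !Bf => E.
  by lia.
move=> q1 q2 q3 l1 l2 l3 C12 C13 C23 fixf.
have [B1 E1] := pair _ _ _ q1 q2 q3 l1 l2 l3 C12 C13 C23 fixf.
have [||B2 E2] := pair a2 a1 a3 q2 q1 q3 l2 l1 l3 _ C23 C13.
- by move=> h; rewrite C12.
- by rewrite -C12.
have [|||B3 E3] := pair a3 a1 a2 q3 q1 q2 l3 l1 l2 _ _ C12.
- by move=> h; rewrite C13.
- by move=> h; rewrite C23.
- by rewrite -C13 -C23.
have y12 p : a1 f p = a2 f p.
  by apply: (mulfI t0); have := E1 p; have := E2 p; lia.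
have y13 p : a1 f p = a3 f p.
  by apply: (mulfI t0); have := E1 p; have := E3 p; lia.
have y1 p : (t + 3) * a1 f p = t * (t + 1) * f p.
  by have := E1 p; rewrite -y12 -y13; lia.
have y2 p : (t - 1) * a1 f p = - (t + 1) * f p.
  have := q1 f p; have a12 : a1 f = a2 f by apply/funext.
  by rewrite {1}a12 B3 -y13; lia.
have y4 p : 4 * a1 f p = (t + 1) ^+ 2 * f p.
  by have := y1 p; have := y2 p; lia.
(* For t = -1 the elimination degenerates, but then y = 0 already. *)
have [t1|t1] := eqVneq (t + 1) 0.
  have y0 p : a1 f p = 0 by have := y4 p; rewrite t1; lia.
  by move=> p; have := q1 f p; rewrite (linear_op0 l1 y0) y0; lia.
move=> p; have t2 : (t + 1) * (t ^+ 2 + 3) != 0.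
  by rewrite mulf_eq0 (negbTE t1) /=; apply/eqP; nia.
apply: (mulfI t2); rewrite mulr0.
have : (t - 1) * (4 * a1 f p) = 4 * ((t - 1) * a1 f p) by ring.
rewrite y4 y2 => /eqP; rewrite -subr_eq0 => /eqP <-; ring.
Qed.

End FixedVectors.

(** * Matrices of size two acting on tensors *)

Local Notation o0 := (ord0 : 'I_2).
Local Notation o1 := (ord_max : 'I_2).

Lemma sum_ord2 (E : 'I_2 -> int) : \sum_i E i = E o0 + E o1.
Proof.
by rewrite big_ord_recl big_ord1; congr (E _ + E _); apply: val_inj.
Qed.

Lemma ord2_ind (P : 'I_2 -> Prop) : P o0 -> P o1 -> forall i, P i.
Proof.
move=> P0 P1 [[|[|[]]]//= i2]; [move: P0 | move: P1]; congr P; exact: val_inj.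
Qed.

Lemma int_unit (x y : int) : x * y = 1 -> x = 1 \/ x = - 1.
Proof.
move=> xy; have x_unit : x \is a GRing.unit by apply/unitrPr; exists y.
by have /orP[] : (x == 1) || (x == - 1) := x_unit; move/eqP; [left | right].
Qed.

Section Matrix.
Variable A : 'I_2 -> 'I_2 -> int.
Implicit Types (f : series 'I_2) (i j k l : 'I_2) (w : seq 'I_2).

(** Functions are used instead of matrices because [linear_part] and
    [tensor_act] make sense over any index type. *)
Definition det2 := A o0 o0 * A o1 o1 - A o0 o1 * A o1 o0.
Definition tr2 := A o0 o0 + A o1 o1.

Lemma det2_unit (b : 'I_2 -> 'I_2 -> int) :
    (forall k j, \sum_i A i j * b k i = (k == j)%:R) ->
  det2 = 1 \/ det2 = -1.
Proof.
move=> Ab; apply: (@int_unit _ (b o0 o0 * b o1 o1 - b o0 o1 * b o1 o0)).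
have := (Ab o0 o0, Ab o0 o1, Ab o1 o0, Ab o1 o1).
rewrite !sum_ord2 /= => -[[[E00 E01] E10] E11].
transitivity ((A o0 o0 * b o0 o0 + A o1 o0 * b o0 o1) *
     (A o0 o1 * b o1 o0 + A o1 o1 * b o1 o1) -
     (A o0 o1 * b o0 o0 + A o1 o1 * b o0 o1) *
     (A o0 o0 * b o1 o0 + A o1 o0 * b o1 o1)).
  by rewrite /det2; ring.
by rewrite E00 E01 E10 E11; ring.
Qed.

(** The value of the characteristic polynomial at 1 is 1 - tr2 + det2.  When it
    vanishes, A fixes the columns of the adjugate of A - 1, and one of them is
    nonzero unless A = 1. *)
Lemma fixed_covector : 1 - tr2 + det2 = 0 ->
  exists l0 l1 : int, [/\ l0 != 0 \/ l1 != 0,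
    A o0 o0 * l0 + A o0 o1 * l1 = l0 & A o1 o0 * l0 + A o1 o1 * l1 = l1].
Proof.
rewrite /tr2 /det2 => D0.
have [[A01 A00]|nz] : (A o0 o1 = 0 /\ A o0 o0 = 1) \/
    (A o0 o1 != 0 \/ 1 - A o0 o0 != 0).
- have [A01|] := eqVneq (A o0 o1) 0; last by right; left.
  have [A00|] := eqVneq (1 - A o0 o0) 0; last by right; right.
  by left; split=> //; lia.
- have [A10|A10] := eqVneq (A o1 o0) 0.
    by exists 1, 0; split; [left | lia | lia].
  by exists (1 - A o1 o1), (A o1 o0); split; [right | lia | lia].
by exists (A o0 o1), (1 - A o0 o0); split=> //; lia.
Qed.

(** The matrix A acting on one tensor factor.  Tensors are functions on a type T
    of multi-indices; get and set read and write the index of that factor. *)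
Definition slot_op T (get : T -> 'I_2) (set : T -> 'I_2 -> T) (f : T -> int) p :=
  \sum_k A k (get p) * f (set p k).

Lemma slot_op_linear T (get : T -> 'I_2) set : linear_op (slot_op get set).
Proof. by move=> m n f g p; rewrite /slot_op !sum_ord2; ring. Qed.

(** The Cayley-Hamilton theorem, applied to one tensor factor. *)
Lemma slot_op_quadratic T (get : T -> 'I_2) set : det2 = -1 ->
  (forall p k, get (set p k) = k) -> (forall p k l, set (set p k) l = set p l) ->
  (forall p, set p (get p) = p) -> quadratic_op tr2 (slot_op get set).
Proof.
move=> detA gs ss sg f p.
suff -> : slot_op get set (slot_op get set f) p =
    tr2 * slot_op get set f p - det2 * f (set p (get p)).
  by rewrite detA mulN1r opprK sg.
rewrite /slot_op !sum_ord2 !gs !ss /det2 /tr2.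
by elim/ord2_ind: (get p); ring.
Qed.

(** The adjugate of 1 - A shows that (1 - tr2 + det2) f = 0. *)
Lemma no_fixed1 f : 1 - tr2 + det2 != 0 ->
    (forall w, size w = 1 -> tensor_act A f w = f w) ->
  forall w, size w = 1 -> f w = 0.
Proof.
move=> D0 fixf.
have E j : f [:: j] - (A o0 j * f [:: o0] + A o1 j * f [:: o1]) = 0.
  by rewrite -[f [:: j] in LHS](fixf [:: j]) //= sum_ord2 subrr.
case=> [|i []] // _; apply: (mulfI D0); rewrite mulr0.
elim/ord2_ind: i; rewrite /tr2 /det2.
  transitivity (
      (1 - A o1 o1) * (f [:: o0] - (A o0 o0 * f [:: o0] + A o1 o0 * f [:: o1]))
    + A o1 o0 * (f [:: o1] - (A o0 o1 * f [:: o0] + A o1 o1 * f [:: o1]))).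
    by ring.
  by rewrite !E !mulr0.
transitivity (
    (1 - A o0 o0) * (f [:: o1] - (A o0 o1 * f [:: o0] + A o1 o1 * f [:: o1]))
  + A o0 o1 * (f [:: o0] - (A o0 o0 * f [:: o0] + A o1 o0 * f [:: o1]))).
  by ring.
by rewrite !E !mulr0.
Qed.

Lemma no_fixed2 f : det2 = -1 -> tr2 != 0 ->
    (forall w, size w = 2 -> tensor_act A f w = f w) ->
  forall w, size w = 2 -> f w = 0.
Proof.
move=> detA tr0 fixf [|i [|j []]] // _.
pose T := ('I_2 * 'I_2)%type.
pose a1 := slot_op (fun p : T => p.1) (fun p k => (k, p.2)).
pose a2 := slot_op (fun p : T => p.2) (fun p k => (p.1, k)).
apply: (@tensor2_no_fixed T tr2 a1 a2 (fun p => f [:: p.1; p.2]) tr0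
  _ _ _ _ _ _ (i, j)).
1-2: by apply: slot_op_quadratic => // -[].
1-2: exact: slot_op_linear.
  by move=> h; apply/funext => p; rewrite /a1 /a2 /slot_op !sum_ord2 /=; ring.
by apply/funext => p; apply: (fixf [:: p.1; p.2]).
Qed.

Lemma no_fixed3 f : det2 = -1 -> tr2 != 0 ->
    (forall w, size w = 3 -> tensor_act A f w = f w) ->
  forall w, size w = 3 -> f w = 0.
Proof.
move=> detA tr0 fixf [|i [|j [|k []]]] // _.
pose T := ('I_2 * 'I_2 * 'I_2)%type.
pose a1 := slot_op (fun p : T => p.1.1) (fun p l => (l, p.1.2, p.2)).
pose a2 := slot_op (fun p : T => p.1.2) (fun p l => (p.1.1, l, p.2)).
pose a3 := slot_op (fun p : T => p.2) (fun p l => (p.1, l)).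
apply: (@tensor3_no_fixed T tr2 a1 a2 a3 (fun p => f [:: p.1.1; p.1.2; p.2]) tr0
  _ _ _ _ _ _ _ _ _ _ (i, j, k)).
1-3: by apply: slot_op_quadratic => // -[[]].
1-3: exact: slot_op_linear.
1-3: move=> h; apply/funext => p.
1-3: by rewrite /a1 /a2 /a3 /slot_op !sum_ord2 /=; ring.
by apply/funext => p; apply: (fixf [:: p.1.1; p.1.2; p.2]).
Qed.

(** * Invariant forms *)

Definition contract (b : 'I_2 -> 'I_2 -> int) f : series 'I_2 :=
  fun w => \sum_i \sum_j b i j * f [:: i, j & w].

(** The bilinear form b satisfies b(A u, A v) = det2 * b(u, v). *)
Definition semi_invariant (b : 'I_2 -> 'I_2 -> int) :=
  forall k l, \sum_i \sum_j b i j * (A k i * A l j) = det2 * b k l.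

Lemma tensor_act_contract b f w : tensor_act A (contract b f) w =
  \sum_i \sum_j b i j * tensor_act A (shift j (shift i f)) w.
Proof.
suff comb (F : 'I_2 -> 'I_2 -> series 'I_2) :
    tensor_act A (fun v => \sum_i \sum_j b i j * F i j v) w =
    \sum_i \sum_j b i j * tensor_act A (F i j) w by exact: comb.
elim: w F => [|k w IHw] F //=.
under eq_bigr => l _ do rewrite (IHw (fun i j => shift l (F i j))).
rewrite !sum_ord2; ring.
Qed.

(** Contraction of the first two tensor factors with a semi-invariant form
    commutes with the action up to the determinant; this allows forms of higher
    degree to be assembled from bilinear ones. *)
Lemma contract_tensor_act b f w : semi_invariant b ->
  contract b (tensor_act A f) w = det2 * tensor_act A (contract b f) w.
Proof.
move=> inv_b; rewrite tensor_act_contract /contract /= !sum_ord2.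
have := (inv_b o0 o0, inv_b o0 o1, inv_b o1 o0, inv_b o1 o1).
rewrite !sum_ord2 => -[[[E00 E01] E10] E11].
rewrite !mulrDr !mulrA -E00 -E01 -E10 -E11; ring.
Qed.

Definition area_form i j : int :=
  ((i == o0) && (j == o1))%:R - ((i == o1) && (j == o0))%:R.

(** The form b(u, v) = area_form(u, A v). *)
Definition twisted_form i j : int := \sum_k A j k * area_form i k.

Lemma area_form_inv : semi_invariant area_form.
Proof.
by move=> k l; rewrite !sum_ord2 /det2; elim/ord2_ind: k; elim/ord2_ind: l;
  rewrite /area_form /=; ring.
Qed.

(** The semi-invariance of the area form, applied to u and A v. *)
Lemma twisted_form_inv : semi_invariant twisted_form.
Proof.
by move=> k l; rewrite /twisted_form !sum_ord2 /det2; elim/ord2_ind: k;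
  elim/ord2_ind: l; rewrite /area_form /=; ring.
Qed.

(** The values b(v, v) at the basis vectors are the off-diagonal entries up to
    sign.  A diagonal integral matrix of determinant -1 has trace 0. *)
Lemma twisted_form_neq0 : det2 = -1 -> tr2 != 0 ->
  exists v, twisted_form v v != 0.
Proof.
move=> det1 tr0.
have [b0 b1] : twisted_form o0 o0 = A o0 o1 /\ twisted_form o1 o1 = - A o1 o0.
  by rewrite /twisted_form !sum_ord2 /area_form /=; split; ring.
have [A01|A01] := eqVneq (A o0 o1) 0; last by exists o0; rewrite b0.
have [A10|A10] := eqVneq (A o1 o0) 0; last by exists o1; rewrite b1 oppr_eq0.
have : A o0 o0 * - A o1 o1 = 1.
  by rewrite mulrN -[RHS]opprK -det1 /det2 A01 mul0r subr0.
by case/int_unit => A00; move: det1 tr0; rewrite /det2 /tr2 A00 A01 A10; lia.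
Qed.

Definition area_functional f := contract area_form f [::].

Definition quartic_functional f :=
  contract twisted_form (contract area_form f) [::].

Lemma area_functional_inv f : det2 = 1 ->
  area_functional (tensor_act A f) = area_functional f.
Proof.
by move=> det1; rewrite /area_functional (contract_tensor_act _ _ area_form_inv)
  det1 mul1r.
Qed.

Lemma quartic_functional_inv f : det2 = -1 ->
  quartic_functional (tensor_act A f) = quartic_functional f.
Proof.
move=> det1; rewrite /quartic_functional.
rewrite (_ : contract area_form (tensor_act A f) =
   fun w => - tensor_act A (contract area_form f) w); last first.
  apply/funext => w; rewrite (contract_tensor_act _ _ area_form_inv).
  by rewrite det1 mulN1r.
transitivity (- contract twisted_form (tensor_act A (contract area_form f)) [::]).
  by rewrite /contract !sum_ord2; ring.
by rewrite (contract_tensor_act _ _ twisted_form_inv) det1 mulN1r opprK.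
Qed.

End Matrix.

(** * Commutators on which the invariant forms do not vanish *)

Section Witness.
Implicit Types (i j k l v : 'I_2).

Definition comm2 : free_group 'I_2 := [~ fg_gen o0, fg_gen o1]%g.
Definition comm4 v := [~ [~ comm2, fg_gen v], fg_gen v]%g.

Lemma vanish_comm2 : vanish 2 (magnus comm2 - 1).
Proof. exact/vanish_commg/vanish_magnus1. Qed.

Lemma comm2_lead i j : (magnus comm2 - 1) [:: i; j] = area_form i j.
Proof.
rewrite (@commg_gen_lead _ _ _ i j [::]); last exact: vanish_magnus1.
rewrite magnus_gen_sub1 /gen /area_form.
by elim/ord2_ind: i; elim/ord2_ind: j.
Qed.

Lemma vanish_comm4 v : vanish 4 (magnus (comm4 v) - 1).
Proof. exact/vanish_commg/vanish_commg/vanish_comm2. Qed.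

Lemma comm4_lead v i j k l : (magnus (comm4 v) - 1) [:: i; j; k; l] =
  (area_form i j * (v == k)%:R - (v == i)%:R * area_form j k) * (v == l)%:R
  - (v == i)%:R * (area_form j k * (v == l)%:R - (v == j)%:R * area_form k l).
Proof.
have v3 := vanish_commg (fg_gen v) vanish_comm2.
rewrite (@commg_gen_lead _ _ v i l [:: j; k]) //=.
rewrite (@commg_gen_lead _ comm2 v i k [:: j]); last exact: vanish_comm2.
rewrite (@commg_gen_lead _ comm2 v j l [:: k]); last exact: vanish_comm2.
by rewrite !comm2_lead.
Qed.

Lemma area_functional_comm2 : area_functional (magnus comm2 - 1) = 2.
Proof. by rewrite /area_functional /contract !sum_ord2 !comm2_lead. Qed.

Lemma quartic_functional_comm4 A v :
  quartic_functional A (magnus (comm4 v) - 1) = 4 * twisted_form A v v.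
Proof.
rewrite /quartic_functional /contract !sum_ord2 !comm4_lead.
elim/ord2_ind: v; rewrite /area_form /=; ring.
Qed.

End Witness.

(** * The theorem *)

(** The rows of an inverse of the matrix of phi are the abelianized preimages of
    the generators. *)
Lemma linear_part_surj (X : finType) c (phi : {multiplicative
    quotient_group (lower_central_subg (free_group X) c.+1) ->
    quotient_group (lower_central_subg (free_group X) c.+1)}) :
    (0 < c)%N -> (forall h, exists g, phi g = h) ->
  forall k, exists b : X -> int,
    forall j, \sum_i linear_part phi i j * b i = (k == j)%:R.
Proof.
move=> c_gt0 surj k; have [g gk] := surj (qproj _ (fg_gen k)).
exists (fun i => (mag g - 1) [:: i]) => j.
have [_ lead] := mag_lead c_gt0 phi c_gt0 (vanish_mag1 g).
have /= <- := lead [:: j] erefl; rewrite gk.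
have := @mag_qproj _ c (fg_gen k) [:: j] c_gt0.
rewrite magnus_gen !(addsE, oppsE) /gen eqseq_cons andbT [j == k]eq_sym => E.
by apply/eqP; rewrite -subr_eq0 -E; apply/eqP; ring.
Qed.

Local Close Scope ring_scope.
Local Close Scope classical_set_scope.

Theorem corollary4p1 (c : nat) (hc : (4 <= c)%N) :
  R_infty (free_nilpotent_group 2 c).
Proof.
move=> phi phi_bij.
have c_gt0 : 0 < c by apply: leq_trans hc.
pose A := linear_part (phi : {multiplicative
    quotient_group (lower_central_subg (free_group 'I_2) c.+1) ->
    quotient_group (lower_central_subg (free_group 'I_2) c.+1)}).
have surj h : exists g, phi g = h.
  by have [psi _ psiK] := phi_bij; exists (psi h).
have [b Ab] := boolp.choice (linear_part_surj c_gt0 surj).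
have [/fixed_covector[l0 [l1 [l_neq0 El0 El1]]]|D0] :=
    eqVneq (1 - tr2 A + det2 A)%R 0%R.
  pose L (f : series 'I_2) : int := (l0 * f [:: ord0] + l1 * f [:: ord_max])%R.
  have [v Lv] : exists v, L (magnus (fg_gen v) - 1)%R <> 0%R.
    by case: l_neq0 => l_neq0; [exists ord0 | exists ord_max];
      rewrite /L magnus_gen_sub1 /gen /=; lia.
  apply: (reidemeister_infinite (k := 1) c_gt0 _ _ _ _ _ (vanish_magnus1 _) Lv).
  - by [].
  - by move=> [|[]].
  - by move=> f g fg; rewrite /L !fg.
  - by move=> f g; rewrite /L !addsE; ring.
  - move=> f.
    transitivity ((A ord0 ord0 * l0 + A ord0 ord_max * l1) * f [:: ord0] +
      (A ord_max ord0 * l0 + A ord_max ord_max * l1) * f [:: ord_max])%R.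
      by rewrite /L /= !sum_ord2 /shift /A; ring.
    by rewrite El0 El1.
have [det1|det1] := det2_unit Ab.
  apply: (reidemeister_infinite (k := 2) (L := area_functional) c_gt0
    _ _ _ _ _ vanish_comm2).
  - by apply: leq_trans hc.
  - by move=> [|[|]] // f _; apply: (no_fixed1 (A := A)).
  - by move=> f g fg; rewrite /area_functional /contract !sum_ord2 !fg.
  - by move=> f g; rewrite /area_functional /contract !sum_ord2 !addsE; ring.
  - by move=> f; apply: area_functional_inv.
  - by rewrite area_functional_comm2.
have tr0 : (tr2 A != 0)%R by apply: contraNneq D0 => tr0; rewrite tr0 det1.
have [v bv] := twisted_form_neq0 det1 tr0.
apply: (reidemeister_infinite (k := 4) (L := quartic_functional A) c_gt0
  _ _ _ _ _ (vanish_comm4 v)).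
- by [].
- move=> [|[|[|[|]]]] // f _.
  + exact: (no_fixed1 (A := A)).
  + exact: (no_fixed2 (A := A)).
  + exact: (no_fixed3 (A := A)).
- by move=> f g fg; rewrite /quartic_functional /contract !sum_ord2 !fg.
- by move=> f g; rewrite /quartic_functional /contract !sum_ord2 !addsE; ring.
- by move=> f; apply: quartic_functional_inv.
- by rewrite quartic_functional_comm4; apply/eqP; rewrite mulf_eq0 negb_or.
Qed.
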